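(* Let $X$ be a real normed space, let $C\subseteq X$ be an open convex set, let $h:C\rightarrow\mathbb{R}$ be a function that is continuous on line segments of $C$, and let $\gamma>0$. Consider the following two conditions. (A) For every $x,y\in C$ and every $z=x+t(y-x)$ with $0<t\leq 1$: $$h(x)\leq h(z)\ \Longrightarrow\ h(z)\leq h(y)-\frac{\gamma}{4}(1-t^{2})\lVert y-x\rVert^{2}.$$ (B) For every $x,y\in C$: $$h(x)\leq h(y)\ \Longrightarrow\ h_{-}^{\prime}(y;y-x)\geq\frac{\gamma}{2}\lVert y-x\rVert^{2}.$$ Then the following assertions hold: (a) $h$ satisfies (A) if and only if $h$ satisfies (B). (b) If $h$ is strongly quasiconvex with modulus $\gamma$, then (B) holds. Conversely, if (B) holds, then $h$ is strongly quasiconvex with modulus $\frac{\gamma}{2}$.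
   Context: A function $h:C\to\mathbb{R}$ on a convex subset $C$ of a normed space $X$ is called strongly quasiconvex with modulus $\gamma>0$ if for every $x,y\in C$ and every $t\in[0,1]$, $$h(x+t(y-x))\leq\max\{h(x),h(y)\}-\frac{\gamma}{2}t(1-t)\lVert y-x\rVert^{2}.$$ ''Continuous on line segments of $C$'' means that for all $x,y\in C$ the map $t\mapsto h(x+t(y-x))$ is continuous on $[0,1]$. For $h$ defined on an open convex set $C\subseteq X$, the lower Dini derivative of $h$ at $x\in C$ in the direction $a\in X$ is $$h_{-}^{\prime}(x;a)=\liminf_{t\rightarrow 0_{+}}\frac{h(x+ta)-h(x)}{t},$$ which is an element of $[-\infty,+\infty]$. *)

(* Defs.v *)
From HB Require Import structures.
From mathcomp Require Import all_boot all_order all_algebra.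
From mathcomp Require Import all_classical all_reals all_analysis.
Import Order.TTheory GRing.Theory Num.Theory.
Import numFieldNormedType.Exports.

Set Implicit Arguments.
Unset Strict Implicit.
Unset Printing Implicit Defensive.

Local Open Scope classical_set_scope.
Local Open Scope ring_scope.

(* A function h : C -> R is represented by a total function h : X -> R; the
   notions below only look at the values of h on C (for [dini_lower h x a], on
   any open C containing x). *)

Definition strongly_quasiconvex (R : realType) (X : normedModType R)
    (C : set X) (h : X -> R) (gamma : R) : Prop :=
  forall x y : X, C x -> C y -> forall t : R, 0 <= t <= 1 ->
    h (x + t *: (y - x)) <=
      Num.max (h x) (h y) - gamma / 2 * (t * (1 - t)) * `|y - x| ^+ 2.

Definition continuous_on_segments (R : realType) (X : normedModType R)
    (C : set X) (h : X -> R) : Prop :=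
  forall x y : X, C x -> C y ->
    {within `[0, 1], continuous (fun t : R => h (x + t *: (y - x)))}.

Definition dini_lower (R : realType) (X : normedModType R)
    (h : X -> R) (x a : X) : \bar R :=
  limf_einf (fun t : R => ((h (x + t *: a) - h x) / t)%:E) 0^'+.

Definition condition_A (R : realType) (X : normedModType R)
    (C : set X) (h : X -> R) (gamma : R) : Prop :=
  forall (x y z : X) (t : R), C x -> C y -> 0 < t <= 1 ->
    z = x + t *: (y - x) ->
    h x <= h z -> h z <= h y - gamma / 4 * (1 - t ^+ 2) * `|y - x| ^+ 2.

Definition condition_B (R : realType) (X : normedModType R)
    (C : set X) (h : X -> R) (gamma : R) : Prop :=
  forall x y : X, C x -> C y -> h x <= h y ->
    ((gamma / 2 * `|y - x| ^+ 2)%R%:E <= dini_lower h y (y - x)%R)%E.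

(* Main.v *)
Require Import Defs.
From HB Require Import structures.
From mathcomp Require Import all_boot all_order all_algebra.
From mathcomp Require Import all_classical all_reals all_analysis.
From mathcomp Require Import ring lra.
Import Order.TTheory GRing.Theory Num.Theory.
Import numFieldNormedType.Exports.

Local Open Scope classical_set_scope.
Local Open Scope ring_scope.

(** Everything happens along a line, where (B) is a differential inequality and
    (A) is its integrated form.  Put [phi s = h (x + s *: (y - x))] and
    [K = gamma / 4 * `|y - x| ^+ 2].

    (A) implies (B), and strong quasiconvexity implies (B)
    ([condition_A_B], [strongly_quasiconvex_B]): given [h x <= h y], prolong the
    segment slightly beyond [y], to [y' = y + s *: (y - x)], which stays in the
    open set [C].  Then [y] lies between [x] and [y'], and the hypothesis at
    [y] bounds [h y' - h y] from below by [s * (gamma / 2 * `|y - x| ^+ 2)].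

    (B) implies (A) ([condition_B_A]): wherever [phi 0 <= phi s], (B) says that
    the lower right derivative of [phi] at [s] is at least [2 * K * s], the
    derivative of [K * s ^+ 2].  Hence for [0 <= c < K] the inequality
    [phi s >= phi t + c * (s ^+ 2 - t ^+ 2)] can never stop holding as [s] grows
    from [t]: it implies [phi s >= phi t >= phi 0], so (B) applies and pushes it
    further to the right.  The set where it holds is closed, so its supremum
    is the end of the segment ([ge0_continuation],
    [condition_B_quadratic_growth]).  Finally [c] tends to [K].

    (A) implies strong quasiconvexity with half the modulus: for [r > 1 / 2],
    compare the values [phi (1 / 2)] and [phi r].  If [phi (1 / 2)] is the smaller
    one, (A) on the segment from the midpoint to [y] gives
    [phi r <= phi 1 - K * (r * (1 - r))]; if [phi r] is, (A) on the segment from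
    [x + r *: (y - x)] back to [x] gives
    [phi (1 / 2) <= phi 0 - K * (r - 1 / 4)], which is at least as strong.  In both
    cases the larger of the two values, hence each of them, is at most
    [Num.max (phi 0) (phi 1) - K * (r * (1 - r))] ([condition_A_half]).
    This settles [t > 1 / 2], by symmetry [t < 1 / 2], and letting [r] tend to
    [1 / 2] in the bound for [phi (1 / 2)] settles the midpoint. *)

(** * Lower Dini derivatives as eventual linear bounds *)

Lemma le_dini_lower {R : realType} {X : normedModType R} (h : X -> R)
    (x a : X) (k : R) :
  (\forall s \near 0^'+, k * s <= h (x + s *: a) - h x) ->
  (k%:E <= dini_lower h x a)%E.
Proof.
move=> kh; rewrite /dini_lower limf_einfE.
set q := fun t : R => ((h (x + t *: a) - h x) / t)%:E.
have kq : \forall s \near 0^'+, (k%:E <= q s)%E.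
  near=> s; have s0 : 0 < s by near: s; exact: nbhs_right_gt.
  by rewrite /q lee_fin ler_pdivlMr//; near: s.
apply: (@le_trans _ _ (ereal_inf (q @` [set s | (k%:E <= q s)%E]))).
  by apply: le_ereal_inf_tmp => _ [s ks <-].
by apply: ereal_sup_ubound; exists [set s | (k%:E <= q s)%E].
Unshelve. all: by end_near. Qed.

(** The inequality has to be strict: a liminf equal to [k] does not make the
    difference quotients eventually at least [k]. *)
Lemma lt_dini_lower {R : realType} {X : normedModType R} (h : X -> R)
    (x a : X) (k : R) :
  (k%:E < dini_lower h x a)%E ->
  \forall s \near 0^'+, k * s <= h (x + s *: a) - h x.
Proof.
rewrite /dini_lower limf_einfE => /ereal_sup_gt[_ [V V0 <-] kV].
near=> s; have s0 : 0 < s by near: s; exact: nbhs_right_gt.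
rewrite -ler_pdivlMr// -lee_fin (le_trans (ltW kV))//.
by apply: ereal_inf_lbound; exists s => //; near: s.
Unshelve. all: by end_near. Qed.

(** * Segments and their prolongations *)

Lemma near_open_ray {R : realType} {X : normedModType R} (C : set X)
    (y a : X) :
  open C -> C y -> \forall s \near (0 : R)^'+, C (y + s *: a).
Proof.
move=> openC Cy.
have : (fun s : R => y + s *: a) @ (0 : R)^'+ --> y + 0 *: a.
  apply: cvgD; first exact: cvg_cst.
  by apply: cvgZl; apply: cvg_at_right_filter; exact: cvg_id.
rewrite scale0r addr0; apply.
exact: open_nbhs_nbhs.
Qed.

Lemma convex_segment {R : realType} {X : normedModType R} (C : set X)
    (x y : X) (s : R) :
  convex_set C -> C x -> C y -> 0 <= s <= 1 -> C (x + s *: (y - x)).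
Proof.
move=> convexC Cx Cy /andP[s0 s1].
have := convexC y x (Itv01 s0 s1); rewrite !inE => /(_ Cy Cx).
rewrite /conv/=; congr (C _).
by rewrite /unstable.onem scalerBl scale1r scalerBr addrCA addrC -addrA.
Qed.

Lemma ray_sub {R : realType} {X : normedModType R} (x y : X) (s : R) :
  y + s *: (y - x) - x = (1 + s) *: (y - x).
Proof. by rewrite scalerDl scale1r addrAC. Qed.

(** The endpoint [y] of a segment, seen as a point of the segment prolonged
    beyond [y]: this puts [y] in the position where (A) and strong
    quasiconvexity say something. *)
Lemma ray_contract {R : realType} {X : normedModType R} (x y : X) (s : R) :
  0 < s -> y = x + (1 + s)^-1 *: (y + s *: (y - x) - x).
Proof.
move=> s0; rewrite ray_sub scalerA mulVf; last by rewrite gt_eqF// addr_gt0.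
by rewrite scale1r addrC subrK.
Qed.

Lemma norm_ray {R : realType} {X : normedModType R} (x y : X) (s : R) :
  0 < s -> `|y + s *: (y - x) - x| = (1 + s) * `|y - x|.
Proof. by move=> s0; rewrite ray_sub normrZ gtr0_norm// addr_gt0. Qed.

(** * Condition (B) from (A) and from strong quasiconvexity *)

(** (A) at [y], as a point of the segment from [x] to [y + s *: (y - x)], bounds
    the increment of [h] by
    [gamma / 4 * ((1 + s) ^+ 2 - 1) * `|y - x| ^+ 2], whose linear part in [s] is
    the slope wanted in (B). *)
Lemma condition_A_B {R : realType} {X : normedModType R} (C : set X)
    (h : X -> R) (gamma : R) :
  open C -> 0 < gamma -> condition_A C h gamma -> condition_B C h gamma.
Proof.
move=> openC g0 hA x y Cx Cy hxy; apply: le_dini_lower; near=> s.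
have s0 : 0 < s by near: s; exact: nbhs_right_gt.
have Cs : C (y + s *: (y - x)).
  by near: s; exact: near_open_ray.
have t01 : 0 < (1 + s)^-1 <= 1.
  by rewrite invr_gt0 addr_gt0// invf_le1 ?lerDl ?addr_gt0// ltW.
have := hA _ _ y _ Cx Cs t01 (ray_contract _ _ _ s0) hxy.
rewrite norm_ray// => hs.
set L := `|y - x| in hs *.
have E : (1 - (1 + s)^-1 ^+ 2) * ((1 + s) * L) ^+ 2 = (2 * s + s ^+ 2) * L ^+ 2.
  by field; rewrite gt_eqF// addr_gt0.
rewrite -mulrA E in hs.
have : 0 <= gamma * (s ^+ 2 * L ^+ 2) by rewrite mulr_ge0 ?(ltW g0)// mulr_ge0// sqr_ge0.
lra.
Unshelve. all: by end_near. Qed.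

(** When [x] and [y] differ, strong quasiconvexity makes [h y] strictly smaller
    than the maximum of [h] over the two ends [x] and [y + s *: (y - x)]; since
    [h x <= h y], the maximum is attained at the new end. *)
Lemma strongly_quasiconvex_B {R : realType} {X : normedModType R} (C : set X)
    (h : X -> R) (gamma : R) :
  open C -> 0 < gamma -> strongly_quasiconvex C h gamma -> condition_B C h gamma.
Proof.
move=> openC g0 hq x y Cx Cy hxy.
have [->|xy] := eqVneq y x.
  apply: le_dini_lower; near=> s.
  by rewrite subrr normr0 expr0n/= mulr0 mul0r scaler0 addr0 subrr.
have L0 : 0 < `|y - x| by rewrite normr_gt0 subr_eq0.
apply: le_dini_lower; near=> s.
have s0 : 0 < s by near: s; exact: nbhs_right_gt.
have Cs : C (y + s *: (y - x)).
  by near: s; exact: near_open_ray.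
have t01 : 0 <= (1 + s)^-1 <= 1.
  by rewrite invr_ge0 addr_ge0 ?(ltW s0)// invf_le1 ?lerDl ?addr_gt0// ltW.
have := hq _ _ Cx Cs _ t01; rewrite -ray_contract// norm_ray// => hs.
set L := `|y - x| in L0 hs *.
have E : (1 + s)^-1 * (1 - (1 + s)^-1) * ((1 + s) * L) ^+ 2 = s * L ^+ 2.
  by field; rewrite gt_eqF// addr_gt0.
rewrite -mulrA E in hs.
have : 0 < gamma * (s * L ^+ 2) by rewrite !mulr_gt0.
by move: hs; case: (leP (h x)) => ? ? ?; lra.
Unshelve. all: by end_near. Qed.

(** * Condition (A) from condition (B) *)

(** The points of the interval where [g] is nonnegative form a closed set, which
    thus contains its supremum; the last hypothesis forbids a supremum smaller
    than [b].  One further nonnegative point to the right is enough, however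
    far: [g] may well be negative in between. *)
Lemma ge0_continuation {R : realType} (g : R -> R) (a b : R) :
  a <= b -> {within `[a, b], continuous g} -> 0 <= g a ->
  (forall s, a <= s < b -> 0 <= g s -> exists2 r, s < r <= b & 0 <= g r) ->
  0 <= g b.
Proof.
move=> ab gcont ga gstep.
pose E := [set s | 0 <= g s] `&` `[a, b].
have [V Vclosed VE] : exists2 V : set R, closed V & V `&` `[a, b] = E.
  apply/closed_subspaceP. move: (gcont) => /continuous_closedP gcl. exact: (gcl _ (@closed_ge _ 0)).

have closedE : closed E.
  by rewrite -VE; apply: closedI => //; exact: interval_closed.
have E0 : E !=set0 by exists a; split => //=; rewrite in_itv/= lexx.
have ubE : ubound E b by move=> s [_ /=]; rewrite in_itv/= => /andP[].
have := closure_sup E0 (ex_intro _ b ubE); rewrite -(closure_id E).1//.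
set m := sup E => -[/= gm]; rewrite in_itv/= => /andP[am mb].
have [mltb|bm] := ltP m b; last by have -> : b = m by apply/eqP; rewrite eq_le bm.
have mab : a <= m < b by rewrite am.
have [r /andP[mr rb] gr] := gstep m mab gm.
have : r <= m.
  apply: ub_le_sup; first by exists b.
  by split => //=; rewrite in_itv/= (le_trans am (ltW mr)).
by rewrite leNgt mr.
Qed.

(** The integrated form of (B), with a constant [c] strictly below the expected
    [gamma / 4 * `|y - x| ^+ 2]: the slack leaves room for the second-order term
    of the quadratic and makes [lt_dini_lower] applicable.  The sign of [c]
    matters: it keeps [h] above [h x] all along, as (B) requires. *)
Lemma condition_B_quadratic_growth {R : realType} {X : normedModType R}
    (C : set X) (h : X -> R) (gamma : R) (x y : X) (t c : R) :
  convex_set C -> continuous_on_segments C h -> condition_B C h gamma ->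
  C x -> C y -> 0 < t <= 1 -> h x <= h (x + t *: (y - x)) ->
  0 <= c < gamma / 4 * `|y - x| ^+ 2 ->
  h (x + t *: (y - x)) + c * (1 - t ^+ 2) <= h y.
Proof.
move=> convexC hcont hB Cx Cy /andP[t0 t1] hxt /andP[c0 cK].
pose phi s := h (x + s *: (y - x)).
have phi1 : h y = phi 1 by rewrite /phi scale1r addrC subrK.
rewrite phi1 -/(phi t) -subr_ge0 -[X in c * (X - _)](expr1n R 2).
apply: (@ge0_continuation R (fun s => phi s - (phi t + c * (s ^+ 2 - t ^+ 2))) t 1)
  => //.
- refine (@continuous_subspaceW R R _ [set` `[0, 1]%R] _ _ _).
    by apply: subset_itvr; rewrite bnd_simp ltW.
  have pcont : {within `[0, 1], continuous (fun s : R => phi t + c * (s ^+ 2 - t ^+ 2))}.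
    apply: continuous_subspaceT => s; apply: cvgD; first exact: cvg_cst.
    apply: cvgM; first exact: cvg_cst.
    apply: cvgB; last exact: cvg_cst.
    exact: exprn_continuous.
  by move=> s; apply: cvgB; [exact: hcont|exact: pcont].
- by rewrite subrr mulr0 addr0 subrr.
move=> s /andP[ts s1] gs.
have s0 : 0 < s by exact: lt_le_trans ts.
have Cs : C (x + s *: (y - x)).
  by apply: convex_segment => //; rewrite !ltW.
have st : t ^+ 2 <= s ^+ 2 by rewrite lerXn2r// nnegrE ltW.
have hxs : h x <= phi s.
  have : 0 <= c * (s ^+ 2 - t ^+ 2) by rewrite mulr_ge0// subr_ge0.
  rewrite -/(phi t) in hxt; lra.
have := hB _ _ Cx Cs hxs.
have -> : x + s *: (y - x) - x = s *: (y - x) by rewrite addrAC subrr add0r.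
rewrite normrZ (gtr0_norm s0) => hD.
set K := gamma / 4 * `|y - x| ^+ 2 in cK.
(* (B) in the direction [s *: (y - x)] gives the slope [s ^+ 2 * (2 * K)] with
   respect to [u], where the next point is [s + s * u]; the quadratic has slope
   [s ^+ 2 * (2 * c)], and [s ^+ 2 * (c + K)] is strictly in between. *)
have kD : ((s ^+ 2 * (c + K))%R%:E < dini_lower h (x + s *: (y - x))%R (s *: (y - x))%R)%E.
  apply: lt_le_trans hD; rewrite lte_fin.
  have -> : gamma / 2 * (s * `|y - x|) ^+ 2 = s ^+ 2 * (K + K).
    by rewrite /K; field.
  by rewrite ltr_pM2l ?exprn_gt0// ltrD2r.
near (0 : R)^'+ => u.
have u0 : 0 < u by near: u; exact: nbhs_right_gt.
have us : s * u <= 1 - s.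
  rewrite mulrC -ler_pdivlMr//; near: u; apply: nbhs_right_le.
  by rewrite divr_gt0 ?subr_gt0.
(* The second-order term [c * s ^+ 2 * u ^+ 2] must fit into the slack
   [(K - c) * s ^+ 2 * u]; dividing by [c + 1] covers [c = 0]. *)
have cu : u * (c + 1) <= K - c.
  rewrite -ler_pdivlMr ?ltr_wpDl//; near: u; apply: nbhs_right_le.
  by rewrite divr_gt0 ?subr_gt0// ltr_wpDl.
have su0 : 0 < s * u by rewrite mulr_gt0.
exists (s + s * u); first by lra.
have : s ^+ 2 * (c + K) * u <= phi (s + s * u) - phi s.
  rewrite {1}/phi (mulrC s u) scalerDl addrA -scalerA.
  by near: u; exact: lt_dini_lower.
have : 0 <= s ^+ 2 * u * (K - c - u * (c + 1)).
  by rewrite mulr_ge0 ?subr_ge0// mulr_ge0 ?sqr_ge0// ltW.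
have : 0 <= s ^+ 2 * u ^+ 2 by rewrite mulr_ge0 ?sqr_ge0.
nra.
Unshelve. all: by end_near. Qed.

(** The constant in [condition_B_quadratic_growth] may be any [c < K], hence
    also [K] itself: otherwise the midpoint between [K] and the actual ratio
    [D / (1 - t ^+ 2)] would be an admissible [c] that violates the growth. *)
Lemma condition_B_A {R : realType} {X : normedModType R} (C : set X)
    (h : X -> R) (gamma : R) :
  convex_set C -> continuous_on_segments C h -> 0 < gamma ->
  condition_B C h gamma -> condition_A C h gamma.
Proof.
move=> convexC hcont g0 hB x y _ t Cx Cy t01 -> hxt.
have growth c := condition_B_quadratic_growth C h gamma x y t c
  convexC hcont hB Cx Cy t01 hxt.
have /andP[t0 t1] := t01.
have [xy|xy] := eqVneq y x.
  by rewrite xy subrr scaler0 addr0 normr0 expr0n/= mulr0 subr0.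
set K := gamma / 4 * `|y - x| ^+ 2 in growth.
have K0 : 0 < K by rewrite mulr_gt0 ?divr_gt0// exprn_gt0// normr_gt0 subr_eq0.
rewrite mulrAC -/K lerBrDr leNgt; apply/negP => hy.
set D := h y - h (x + t *: (y - x)).
have D0 : 0 <= D.
  by have := growth 0; rewrite lexx K0 mul0r addr0 subr_ge0; apply.
have [t1'|t1'] := eqVneq t 1.
  by move: hy D0; rewrite /D t1' expr1n subrr mulr0 addr0; lra.
have W0 : 0 < 1 - t ^+ 2.
  by rewrite subr_gt0 expr_lt1 ?ltW// lt_neqAle t1' t1.
have DK : D / (1 - t ^+ 2) < K by rewrite ltr_pdivrMr// /D; lra.
have := growth ((D / (1 - t ^+ 2) + K) / 2).
have -> : 0 <= (D / (1 - t ^+ 2) + K) / 2 < K.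
  have : 0 <= D / (1 - t ^+ 2) by rewrite divr_ge0// ltW.
  lra.
move=> /(_ isT).
have -> : (D / (1 - t ^+ 2) + K) / 2 * (1 - t ^+ 2) = (D + K * (1 - t ^+ 2)) / 2.
  by field; rewrite gt_eqF.
rewrite /D; lra.
Qed.

(** * Strong quasiconvexity from condition (A) *)

(** Whichever of the two points has the smaller value serves as the base point
    of (A), which bounds the larger value.  The bound for the midpoint is kept
    because (A), where [t = 0] is excluded, does not yield it with [r = 1 / 2]. *)
Lemma condition_A_half {R : realType} {X : normedModType R} (C : set X)
    (h : X -> R) (gamma : R) (x y : X) (r : R) :
  convex_set C -> 0 < gamma -> condition_A C h gamma -> C x -> C y ->
  1 / 2 < r <= 1 ->
  let bound := Num.max (h x) (h y) - gamma / 4 * (r * (1 - r)) * `|y - x| ^+ 2 in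
  h (x + (1 / 2) *: (y - x)) <= bound /\ h (x + r *: (y - x)) <= bound.
Proof.
move=> convexC g0 hA Cx Cy /andP[r2 r1] bound.
set w := x + (1 / 2) *: (y - x); set z := x + r *: (y - x).
have Cw : C w by apply: convex_segment => //; lra.
have Cz : C z by apply: convex_segment => //; lra.
have yw : y - w = (1 / 2) *: (y - x).
  rewrite /w opprD addrA -{1}(scale1r (y - x)) -scalerBl; congr (_ *: _).
  by field.
have xz : x - z = - r *: (y - x) by rewrite /z opprD addrA subrr add0r scaleNr.
have [hwz|/ltW hzw] := leP (h w) (h z).
  (* On the segment from [w] to [y], the point [z] has parameter [2 * r - 1]. *)
  have : h z <= h y - gamma / 4 * (1 - (2 * r - 1) ^+ 2) * `|y - w| ^+ 2.
    apply: (hA w y z _ Cw Cy _ _ hwz).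
      lra.
    by rewrite yw scalerA /z /w -addrA -scalerDl; congr (_ + _ *: _); field.
  rewrite yw normrZ ger0_norm; last by lra.
  have -> : gamma / 4 * (1 - (2 * r - 1) ^+ 2) * (1 / 2 * `|y - x|) ^+ 2 =
    gamma / 4 * (r * (1 - r)) * `|y - x| ^+ 2 by field.
  move=> hz.
  suff : h z <= bound by move=> hzb; split => //; exact: le_trans hzb.
  by rewrite (le_trans hz)// lerB// le_max lexx orbT.
have r0 : 0 < r by lra.
(* On the segment from [z] to [x], the point [w] has parameter
   [1 - (2 * r)^-1]. *)
have : h w <= h x - gamma / 4 * (1 - (1 - (2 * r)^-1) ^+ 2) * `|x - z| ^+ 2.
  apply: (hA z x w _ Cz Cx _ _ hzw).
    have : (2 * r)^-1 < 1 by rewrite invf_lt1; lra.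
    have : 0 < (2 * r)^-1 by rewrite invr_gt0; lra.
    lra.
  rewrite xz scalerA /z /w -addrA -scalerDl; congr (_ + _ *: _); field.
  by rewrite gt_eqF.
rewrite xz normrZ normrN gtr0_norm//.
have -> : gamma / 4 * (1 - (1 - (2 * r)^-1) ^+ 2) * (r * `|y - x|) ^+ 2 =
    gamma / 4 * (r - 1 / 4) * `|y - x| ^+ 2.
  by field; rewrite gt_eqF.
move=> hw.
suff : h w <= bound by move=> hwb; split => //; exact: le_trans hwb.
rewrite (le_trans hw)// lerB ?le_max ?lexx//.
rewrite ler_wpM2r ?sqr_ge0// ler_wpM2l; [by []|lra|].
(* [r * (1 - r) <= r - 1 / 4] amounts to [1 / 2 <= r] for positive [r]. *)
nra.
Qed.

Lemma condition_A_strongly_quasiconvex {R : realType} {X : normedModType R}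
    (C : set X) (h : X -> R) (gamma : R) :
  convex_set C -> 0 < gamma -> condition_A C h gamma ->
  strongly_quasiconvex C h (gamma / 2).
Proof.
move=> convexC g0 hA x y Cx Cy t /andP[t0 t1].
have -> : gamma / 2 / 2 = gamma / 4 by field.
have [t2|t2|->] := ltgtP t (1 / 2).
- have -> : x + t *: (y - x) = y + (1 - t) *: (x - y).
    rewrite -[x - y]opprB scalerN scalerBl scale1r opprB addrCA subKr.
    by rewrite addrC.
  have -> : t * (1 - t) = (1 - t) * (1 - (1 - t)) by ring.
  rewrite maxC distrC.
  by apply: (condition_A_half _ _ _ _ _ _ _ g0 hA _ _ _).2 => //; lra.
- by apply: (condition_A_half _ _ _ _ _ _ _ g0 hA _ _ _).2 => //; lra.
(* At the midpoint, [condition_A_half] is used with [r = 1 / 2 + e] and [e]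
   tending to 0. *)
set K := gamma / 4 * `|y - x| ^+ 2.
have K0 : 0 <= K by rewrite mulr_ge0 ?sqr_ge0//; lra.
have mid (e : R) : 0 < e <= 1 / 2 ->
    h (x + (1 / 2) *: (y - x)) <= Num.max (h x) (h y) - K * (1 / 4 - e ^+ 2).
  move=> e01; have r01 : 1 / 2 < 1 / 2 + e <= 1 by lra.
  have [+ _] := condition_A_half _ _ _ _ _ _ convexC g0 hA Cx Cy r01.
  suff -> : gamma / 4 * ((1 / 2 + e) * (1 - (1 / 2 + e))) * `|y - x| ^+ 2 =
    K * (1 / 4 - e ^+ 2) by [].
  by rewrite /K; field.
apply/ler_addgt0Pr => e e0.
pose d := Num.min (1 / 2) (e / (K + 1)).
have d0 : 0 < d by rewrite lt_min !divr_gt0// ltr_wpDl.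
have d2 : d <= 1 / 2 by rewrite ge_min lexx.
have dK : d * (K + 1) <= e.
  by rewrite -ler_pdivlMr ?ltr_wpDl// ge_min lexx orbT.
have := mid d; rewrite d0 d2 => /(_ isT) /le_trans; apply.
have -> : gamma / 4 * (1 / 2 * (1 - 1 / 2)) * `|y - x| ^+ 2 = K / 4.
  by rewrite /K; field.
have Kd0 : 0 <= K * d by rewrite mulr_ge0// ltW.
have : K * d * d <= K * d by rewrite ler_piMr//; lra.
nra.
Qed.

Theorem theorem6 (R : realType) (X : normedModType R) (C : set X)
    (h : X -> R) (gamma : R)
    (openC : open C) (convexC : convex_set C)
    (hcont : continuous_on_segments C h) (gamma_gt0 : 0 < gamma) :
  (condition_A C h gamma <-> condition_B C h gamma) /\
  ((strongly_quasiconvex C h gamma -> condition_B C h gamma) /\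
   (condition_B C h gamma -> strongly_quasiconvex C h (gamma / 2))).
Proof.
split; first split.
- exact: condition_A_B.
- exact: condition_B_A.
split; first exact: strongly_quasiconvex_B.
move=> hB; apply: condition_A_strongly_quasiconvex => //.
exact: condition_B_A.
Qed.
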